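(* Let $\sigma>0$ and $\varepsilon>0$. Let $0\le g_0\in L^1_2$ satisfy $$\int_{\mathbb{R}}g_0(v)\,dv=1,\qquad \int_{\mathbb{R}}v\,g_0(v)\,dv=0,\qquad \int_{\mathbb{R}}v^2g_0(v)\,dv=E<\infty.$$ Let $g_\varepsilon$ be the solution, with initial condition $g_\varepsilon(\cdot,0)=g_0$, to the Rosenau-type approximation $$\frac{\partial g_\varepsilon}{\partial t}=\frac{\lambda}{\varepsilon^2}\left[M_\varepsilon*g_\varepsilon-g_\varepsilon\right]$$ with $\lambda=\sigma^2$ and the Rosenau kernel $$M_\varepsilon(v)=\frac{1}{2\varepsilon}\,e^{-|v|/\varepsilon}.$$ Then the scaled distribution $h_\varepsilon(v,t):=V(t)^{-1}g_\varepsilon\left(V(t)^{-1}v,t\right)$, where $V(t):=(1+t)^{-1/2}$, verifies for all $t\ge0$ $$d_2\left(h_\varepsilon(t),\omega_\sigma\right)\le\frac{1}{1+t}\,d_2(g_0,\omega_\sigma)+\sqrt{\frac{\sigma^2}{2}}\;\varepsilon\,\frac{\sqrt t}{1+t}.$$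
   Context: The Fourier transform is $\widehat f(\xi)=\int_{\mathbb{R}}e^{-i\xi v}f(v)\,dv$; $*$ is convolution in $v$. The weighted space $L^1_2$ is the set of measurable $f:\mathbb{R}\to\mathbb{R}$ with $\int_{\mathbb{R}}|f(v)|(1+v^2)\,dv<\infty$. For two probability distributions $f_1,f_2$ on $\mathbb{R}$, $$d_2(f_1,f_2):=\sup_{\xi\in\mathbb{R}\setminus\{0\}}\frac{|\widehat f_1(\xi)-\widehat f_2(\xi)|}{|\xi|^2}.$$ The Gaussian is $\omega_\sigma(v)=\frac{1}{\sqrt{4\pi\sigma^2}}\exp\left(-\frac{v^2}{4\sigma^2}\right)$, with $\widehat\omega_\sigma(\xi)=\exp(-\sigma^2\xi^2)$. The equation for $g_\varepsilon$ is understood in weak form, i.e. $\frac{d}{dt}\int g_\varepsilon\varphi\,dv=\frac{\lambda}{\varepsilon^2}\int\varphi\,(M_\varepsilon*g_\varepsilon-g_\varepsilon)\,dv$ for smooth $\varphi$; its solution is given in Fourier variables by $\widehat{g_\varepsilon}(\xi,t)=\widehat{g_0}(\xi)\exp(-A_\varepsilon(\xi)t)$ with $A_\varepsilon(\xi)=\lambda\,\frac{1-\widehat{M_\varepsilon}(\xi)}{\varepsilon^2}$. Here $h_\varepsilon(t)$ denotes $h_\varepsilon(\cdot,t)$. *)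

(* Defs.v *)
From mathcomp Require Import all_boot all_order all_algebra.
From mathcomp Require Import all_classical all_reals all_analysis.
From mathcomp Require Import complex.

Set Implicit Arguments.
Unset Strict Implicit.
Unset Printing Implicit Defensive.

Import Order.TTheory GRing.Theory Num.Theory.
Import numFieldNormedType.Exports.

Local Open Scope classical_set_scope.
Local Open Scope ring_scope.

Section Defs.
Context {R : realType}.
Local Notation mu := (@lebesgue_measure R).
Implicit Types (f g k : R -> R).

Definition expi (x : R) : R[i] := Complex (cos x) (sin x).

(* The integral over the line of a complex-valued function, componentwise. *)
Definition Cintegral (F : R -> R[i]) : R[i] :=
  Complex (\int[mu]_v complex.Re (F v)) (\int[mu]_v complex.Im (F v)).

Definition fourier f (xi : R) : R[i] :=
  Cintegral (fun v => expi (- (xi * v)) * (f v)%:C%C).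

Definition convolution f g : R -> R := fun v => \int[mu]_w (f (v - w) * g w).

Definition in_L12 f : Prop :=
  measurable_fun setT f /\
  (\int[mu]_v (`|f v| * (1 + v ^+ 2))%:E < +oo)%E.

(* The supremum is taken in the extended reals, as it may be infinite for
   arbitrary f and g. *)
Definition d2 f g : \bar R :=
  ereal_sup [set (Normc.normc (fourier f xi - fourier g xi) / `|xi| ^+ 2)%:E
            | xi in [set xi : R | xi != 0]].

Definition gaussian (sigma : R) : R -> R := fun v =>
  (Num.sqrt (4 * pi * sigma ^+ 2))^-1 * expR (- (v ^+ 2 / (4 * sigma ^+ 2))).

Definition rosenau_kernel (eps : R) : R -> R := fun v =>
  (2 * eps)^-1 * expR (- (`|v| / eps)).

(* Smooth functions, bounded together with all their derivatives.  This class
   contains v |-> cos (xi * v) and v |-> sin (xi * v), i.e. the real and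
   imaginary parts of the test functions giving the Fourier transform. *)
Definition test_function (phi : R -> R) : Prop :=
  forall n : nat, (forall x, derivable (derive1n n phi) x 1) /\
                  (exists C : R, forall x, `|derive1n n phi x| <= C).

(* g v t, for t >= 0, is a weak solution of
     d/dt g = (lambda / eps ^+ 2) * (k * g - g)   (k * g a convolution in v)
   with initial datum g0.  The values g v t with t < 0 are irrelevant. *)
Definition weak_solution (lambda eps : R) k g0 (g : R -> R -> R) : Prop :=
  [/\ forall t : R, 0 <= t -> mu.-integrable setT (EFin \o g^~ t),
      forall v, g v 0 = g0 v
    & forall phi, test_function phi ->
        (\int[mu]_v (g v t * phi v) @[t --> 0^'+] -->
          \int[mu]_v (g v 0 * phi v)) /\
        forall t : R, 0 < t ->
          is_derive t (1 : R) (fun s => \int[mu]_v (g v s * phi v))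
            (lambda / eps ^+ 2 *
             \int[mu]_v (phi v * (convolution k (g^~ t) v - g v t)))].

Definition scaling (t : R) : R := (1 + t) `^ (- (1 / 2)).

Definition rescaled (g : R -> R -> R) (t : R) : R -> R := fun v =>
  (scaling t)^-1 * g ((scaling t)^-1 * v) t.

End Defs.

(* Main.v *)
Require Import Defs.
From mathcomp Require Import all_boot all_order all_algebra.
From mathcomp Require Import all_classical all_reals all_analysis.
From mathcomp Require Import measurable_realfun complex ring lra.

Import Order.TTheory GRing.Theory Num.Theory.
Import numFieldNormedType.Exports.

Local Open Scope classical_set_scope.
Local Open Scope ring_scope.

(** The equation is linear and translation invariant, so in Fourier variables
    it decouples into scalar equations.  The kernel is even and its transform
    is 1 / (1 + (eps * xi)^2); testing the equation against the waves
    a cos(xi v) + b sin(xi v) and exchanging the integrals gives, for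
    F(t) = int g(v, t) (a cos(xi v) + b sin(xi v)) dv, the equation
    F' = - A(xi) F with A(xi) = sigma^2 xi^2 / (1 + (eps * xi)^2).  Hence the
    transform of g(t) is exp(- A(xi) t) times that of g0
    ([fourier_weak_solution]), whereas that of the Gaussian is
    exp(- sigma^2 xi^2) ([fourier_gaussian]).

    Rescaling replaces xi by eta = V(t) xi, so that xi^2 = (1 + t) eta^2 and
    exp(- sigma^2 xi^2) = exp(- sigma^2 eta^2) exp(- sigma^2 eta^2 t).  Writing
    W for the transform of the Gaussian at eta, A for A(eta) and
    B = sigma^2 eta^2, the difference of the two transforms at xi is
      exp(- A t) (g0^(eta) - W) + (exp(- A t) - exp(- B t)) W.
    The first factor and W lie in [0, 1], so after division by xi^2 the first
    term contributes d2 (g0, gaussian) / (1 + t).  As A = B / (1 + d) with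
    d = (eps * eta)^2, the second term is the gap between
    exp(- B t / (1 + d)) and exp(- B t), which [expR_gap] bounds by
    sqrt (B t d / 2) = sqrt (sigma^2 / 2) eps sqrt(t) eta^2. *)

(** * Affine change of variables for the Lebesgue measure *)

Section affine.
Context {R : realType}.
Local Notation mu := (@lebesgue_measure R).

Definition affine (c b x : R) : R := c * x + b.

Lemma measurable_affine c b :
  measurable_fun setT (affine c b : measurableTypeR R -> measurableTypeR R).
Proof.
exact: measurable_funD => //; exact: measurable_funM.
Qed.

(** The image of the Lebesgue measure under an affine map, packed as a
    measure: by uniqueness it is a multiple of the Lebesgue measure. *)
Definition affine_image (c b : R) : {measure set (measurableTypeR R) -> \bar R}.
Proof.
unshelve refine (pushforward mu
  (affine c b : measurableTypeR R -> measurableTypeR R) :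
    {measure set _ -> \bar R}).
exact: measurable_affine.
Defined.

(** It suffices to compare the two measures on half-open intervals, whose
    preimages are intervals of length divided by the absolute value of c; when
    c is negative the endpoints are exchanged. *)
Lemma lebesgue_measure_affine (c b : R) (c0 : c != 0)
    (A : set (measurableTypeR R)) : measurable A ->
  mu A = (`|c|%:E * mu (affine c b @^-1` A))%E.
Proof.
move=> mA; apply: (@lebesgue_measure_unique _
  (mscale (NngNum (normr_ge0 c)) (affine_image c b))) => //.
move=> _ [[u v]] _ <-.
change (mu `]u, v]%classic = `|c|%:E * mu (affine c b @^-1` `]u, v]%classic))%E.
have [cp|cn] := ltP 0 c.
  have -> : affine c b @^-1` `]u, v]%classic =
      `](u - b) / c, (v - b) / c]%classic.
    by apply/seteqP; split => x /=; rewrite !in_itv/= /affine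
      ltr_pdivrMr// ler_pdivlMr// ltrBlDr lerBrDr (mulrC x).
  rewrite !lebesgue_measure_itv/= !lte_fin ltr_pM2r ?invr_gt0// ltrD2r.
  case: ifPn => _; last by rewrite mule0.
  by rewrite -!EFinB -EFinM gtr0_norm//; congr EFin; field.
have {}cn : c < 0 by rewrite lt_neqAle c0.
have -> : affine c b @^-1` `]u, v]%classic =
    `[(v - b) / c, (u - b) / c[%classic.
  by apply/seteqP; split => x /=; rewrite !in_itv/= /affine
    ltr_ndivlMr// ler_ndivrMr// ltrBlDr lerBrDr (mulrC x) andbC.
rewrite !lebesgue_measure_itv/= !lte_fin ltr_nM2r ?invr_lt0// ltrD2r.
case: ifPn => _; last by rewrite mule0.
by rewrite -!EFinB -EFinM ltr0_norm//; congr EFin; field.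
Qed.

Lemma ge0_integral_affine (c b : R) (f : R -> \bar R) : c != 0 ->
  measurable_fun setT f -> (forall x, 0 <= f x)%E ->
  (\int[mu]_x f x = `|c|%:E * \int[mu]_x f (affine c b x))%E.
Proof.
move=> c0 mf f0.
transitivity (\int[mscale (NngNum (normr_ge0 c)) (affine_image c b)]_x f x)%E.
  by apply: eq_measure_integral => A mA _; exact: lebesgue_measure_affine.
rewrite ge0_integral_mscale//; congr (_ * _)%E.
rewrite /affine_image ge0_integral_pushforward//.
exact: measurable_affine.
Qed.

Lemma integrable_affine (c b : R) (f : R -> R) : c != 0 ->
  mu.-integrable setT (EFin \o f) ->
  mu.-integrable setT (EFin \o (f \o affine c b)).
Proof.
move=> c0 /integrableP[/measurable_EFinP mf foo].
apply/integrableP; split.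
  apply/measurable_EFinP; apply: (measurableT_comp mf).
  exact: measurable_affine.
move: foo; rewrite (ge0_integral_affine c b)//; last first.
  by apply: measurableT_comp => //; exact/measurable_EFinP.
rewrite !ltey; apply: contra => /eqP ->.
by rewrite gt0_muley// lte_fin normr_gt0.
Qed.

Lemma Rintegral_affine (c b : R) (f : R -> R) : c != 0 ->
  mu.-integrable setT (EFin \o f) ->
  \int[mu]_x f x = `|c| * \int[mu]_x f (affine c b x).
Proof.
move=> c0 fi.
have fci : mu.-integrable setT ((EFin \o f) \o affine c b).
  exact: integrable_affine.
have mf : measurable_fun setT (EFin \o f) by exact: measurable_int fi.
have pI := integrable_pos_fin_num measurableT fci.
have nI := integrable_neg_fin_num measurableT fci.
have pE := funepos_comp (EFin \o f) (affine c b).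
have nE := funeneg_comp (EFin \o f) (affine c b).
rewrite pE in pI; rewrite nE in nI.
rewrite /Rintegral integralE [in RHS]integralE.
rewrite -[fun x => (f (affine c b x))%:E]/((EFin \o f) \o affine c b).
rewrite pE nE {pE nE}.
rewrite (ge0_integral_affine c b (funepos (EFin \o f)))//;
  last exact: measurable_funepos.
rewrite (ge0_integral_affine c b (funeneg (EFin \o f)))//;
  last exact: measurable_funeneg.
rewrite -muleBr//; last exact: fin_num_adde_defr.
by rewrite fineM// fin_numB pI nI.
Qed.

End affine.

(** * Parity and the fundamental theorem of calculus on a half-line *)

Section line.
Context {R : realType}.
Local Notation mu := (@lebesgue_measure R).

Lemma Rintegral_odd (f : R -> R) : mu.-integrable setT (EFin \o f) ->
  (forall x, f (- x) = - f x) -> \int[mu]_x f x = 0.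
Proof.
move=> fi fN; suff : \int[mu]_x f x = - \int[mu]_x f x by lra.
rewrite {1}(Rintegral_affine (-1) 0) ?oppr_eq0 ?oner_eq0//.
rewrite normrN1 mul1r /affine.
under eq_Rintegral do rewrite addr0 mulN1r fN -mulN1r.
by rewrite RintegralZl// mulN1r.
Qed.

Lemma Rintegral_even (f : R -> R) : mu.-integrable setT (EFin \o f) ->
  (forall x, f (- x) = f x) ->
  \int[mu]_x f x = 2 * \int[mu]_(x in `[0, +oo[) f x.
Proof.
move=> fi fN.
have fiS (A : set R) : measurable A -> mu.-integrable A (EFin \o f).
  by move=> mA; exact: integrableS fi.
have -> : [set: R] = `]-oo, 0[%classic `|` `[0, +oo[%classic.
  by rewrite -setCitvl setUv.
rewrite Rintegral_setU//; last 2 first.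
- by apply: fiS; exact: measurableU.
- by apply/disj_setPS; rewrite -setCitvl setICr.
rewrite mulr_natl mulr2n; congr +%R.
rewrite Rintegral_mkcond (Rintegral_affine (-1) 0) ?oppr_eq0 ?oner_eq0//;
  last first.
  rewrite -restrict_EFin; apply: (iffLR (integrable_mkcond _ _)) => //.
  exact: fiS.
rewrite normrN1 mul1r -Rintegral_itv_obnd_cbnd; last exact: fiS.
rewrite [RHS]Rintegral_mkcond; apply: eq_Rintegral => x _.
rewrite !patchE /affine addr0 mulN1r.
by rewrite !mem_setE !in_itv/= oppr_lt0 andbT fN//.
Qed.

Lemma EFin_Rintegral (h : R -> R) : mu.-integrable setT (EFin \o h) ->
  (\int[mu]_x (h x)%:E)%E = (\int[mu]_x h x)%:E.
Proof. by move=> hi; rewrite fineK//; exact: integrable_fin_num. Qed.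

(** No sign is imposed on f, so monotone convergence is not available:
    integrability lets dominated convergence pass to the limit in
    int_0^n f = F n - F 0. *)
Lemma Rintegral_FTC2y (f F : R -> R) (l : R) :
  (forall x, is_derive x (1:R) F (f x)) -> continuous f ->
  mu.-integrable `[0, +oo[ (EFin \o f) -> F x @[x --> +oo] --> l ->
  \int[mu]_(x in `[0, +oo[) f x = l - F 0.
Proof.
move=> dF cf fi Fl.
have cF : continuous F.
  move=> x; apply/differentiable_continuous/derivable1_diffP.
  by have [] := dF x.
(* n.+1 rather than n, so that the interval is never degenerate *)
pose f_ (n : nat) : R -> R := f \_ `[0, n.+1%:R].
have f_E n : (\int[mu]_(x in `[0%R, +oo[) (f_ n x)%:E = (F n.+1%:R - F 0)%:E)%E.
  rewrite EFinB -(@continuous_FTC2 _ f F 0 n.+1%:R)//; last 3 first.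
  - exact: continuous_subspaceT.
  - split; [by move=> x _; have [] := dF x | exact/cvg_at_right_filter/cF |].
    exact/cvg_at_left_filter/cF.
  - by move=> x _; rewrite derive1E; have [_ ->] := dF x.
  transitivity (\int[mu]_(x in `[0%R, +oo[)
      ((EFin \o f) \_ `[0%R, n.+1%:R]) x)%E.
    by rewrite restrict_EFin.
  rewrite -integral_mkcondr; congr (integral _ _ _).
  apply/seteqP; split => x /=; rewrite !in_itv/=; first by case=> _.
  by move=> /andP[-> ->].
have mf : measurable_fun setT f by exact: continuous_measurable_fun.
have mf_ n : measurable_fun setT (f_ n).
  by apply/(measurable_restrict _ _ _) => //; exact: measurable_funS mf.
have mEf_ n : measurable_fun (`[0%R, +oo[%classic : set R) (EFin \o f_ n).
  by apply/measurable_EFinP/measurable_funTS.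
have mEf : measurable_fun (`[0%R, +oo[%classic : set R) (EFin \o f).
  by apply/measurable_EFinP/measurable_funTS.
have f_f x : 0 <= x -> (f_ n x)%:E @[n --> \oo] --> (f x)%:E.
  move=> x0.
  apply: cvg_near_cst; near=> n; congr EFin.
  rewrite /f_ patchE mem_set//= in_itv/= x0/= (@le_trans _ _ n%:R)//.
    near: n; exact: nbhs_infty_ger.
  by rewrite ler_nat.
have f_le x n : (`|(f_ n x)%:E| <= `|(f x)%:E|)%E.
  rewrite /f_ patchE; case: ifPn => _ //=.
  by rewrite normr0 lee_fin.
have [||_ _] := @dominated_convergence _ (measurableTypeR R) R mu
    `[0%R, +oo[%classic (measurable_itv _) (fun n => EFin \o f_ n) (EFin \o f)
    _ mEf_ mEf _ (integrable_abse fi).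
- by apply: aeW => x; rewrite /= in_itv/= andbT; exact: f_f.
- by apply: aeW => x n _; exact: f_le.
rewrite [X in X @ _ --> _](_ : _ = (fun n => (F n.+1%:R - F 0)%:E)); last first.
  by apply/funext => n; exact: f_E.
move=> /(cvg_lim (@ereal_hausdorff R)) H; rewrite /Rintegral.
suff -> : (\int[mu]_(x in `[0%R, +oo[) (f x)%:E)%E = (l - F 0)%:E by [].
rewrite -[LHS]H.
apply/cvg_lim => //; apply: cvg_EFin; first exact: nearW.
apply: cvgB; last exact: cvg_cst.
move/cvg_pinftyP : Fl => /(_ (fun n => n.+1%:R)); apply.
by apply/cvgryPge => r; near=> n; rewrite (@le_trans _ _ n%:R) ?ler_nat//;
  near: n; exact: nbhs_infty_ger.
Unshelve. all: by end_near. Qed.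
End line.

(** * Trigonometric waves *)

Section wave.
Context {R : realType}.
Local Notation mu := (@lebesgue_measure R).

Lemma integrableM_bounded {d} {T : measurableType d}
    {m : {measure set T -> \bar R}} {D : set T} {f phi : T -> R} (C : R) :
  measurable D -> m.-integrable D (EFin \o f) -> measurable_fun setT phi ->
  (forall x, `|phi x| <= C) -> m.-integrable D (EFin \o (phi \* f)).
Proof.
move=> mD fi mphi phiC.
have mf := measurable_int _ fi.
apply: le_integrable (integrableZl mD C fi) => //.
- apply/measurable_EFinP/measurable_funM; first exact: measurable_funTS.
  exact/measurable_EFinP.
- move=> x _ /=; rewrite lee_fin !normrM ler_wpM2r//.
  exact: le_trans (phiC x) (ler_norm C).
Qed.

(** Carrying the two amplitudes handles the real and imaginary parts of the
    Fourier transform at once, and makes the family of waves of frequency xi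
    stable under differentiation and translation. *)
Definition wave (a b xi v : R) : R := a * cos (xi * v) + b * sin (xi * v).

Lemma wave_cos xi v : wave 1 0 xi v = cos (xi * v).
Proof. by rewrite /wave mul1r mul0r addr0. Qed.

Lemma wave_sin xi v : wave 0 1 xi v = sin (xi * v).
Proof. by rewrite /wave mul1r mul0r add0r. Qed.

Lemma le_norm_wave a b xi v : `|wave a b xi v| <= `|a| + `|b|.
Proof.
rewrite (le_trans (ler_normD _ _))// lerD// normrM ler_piMr//.
- exact: cos_max.
- exact: sin_max.
Qed.

Lemma is_derive_mulr (f : R -> R) (c x df : R) : is_derive (c * x) (1:R) f df ->
  is_derive x (1:R) (fun y => f (c * y)) (c * df).
Proof.
move=> fd; have cd : is_derive x (1:R) ( *%R c) c.
  by apply: is_derive_eq; rewrite scaler1.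
have := @is_derive1_comp _ f ( *%R c) _ _ _ fd cd.
by rewrite mulrC.
Qed.

Lemma is_derive_wave a b xi v :
  is_derive v (1:R) (wave a b xi) (wave (xi * b) (- (xi * a)) xi v).
Proof.
have dc : is_derive v (1:R) (fun y => cos (xi * y)) (xi * - sin (xi * v)).
  exact: is_derive_mulr.
have ds : is_derive v (1:R) (fun y => sin (xi * y)) (xi * cos (xi * v)).
  exact: is_derive_mulr.
by apply: is_derive_eq; rewrite /wave /GRing.scale/=; ring.
Qed.

Lemma continuous_wave a b xi : continuous (wave a b xi).
Proof.
move=> x; apply/differentiable_continuous/derivable1_diffP.
by have [] := is_derive_wave a b xi x.
Qed.

Lemma measurable_wave a b xi : measurable_fun setT (wave a b xi).
Proof. exact: continuous_measurable_fun (continuous_wave a b xi). Qed.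

Lemma derive1n_wave a b xi n :
  exists a' b', derive1n n (wave a b xi) = wave a' b' xi.
Proof.
elim: n => [|n [a' [b' IH]]]; first by exists a, b.
exists (xi * b'), (- (xi * a')).
rewrite derive1nS IH; apply/funext => v; rewrite derive1E.
by have [_ ->] := is_derive_wave a' b' xi v.
Qed.

Lemma test_function_wave a b xi : test_function (wave a b xi).
Proof.
move=> n; have [a' [b' ->]] := derive1n_wave a b xi n; split.
  by move=> x; have [] := is_derive_wave a' b' xi x.
by exists (`|a'| + `|b'|) => x; exact: le_norm_wave.
Qed.

Lemma waveD a b xi u w :
  wave a b xi (u + w) =
  wave a b xi w * cos (xi * u) + wave b (- a) xi w * sin (xi * u).
Proof. by rewrite /wave mulrDr cosD sinD; ring. Qed.

Lemma cvg0_bounded (f g : R -> R) (C : R) :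
  f x @[x --> +oo] --> 0 -> (forall x, `|g x| <= C) ->
  f x * g x @[x --> +oo] --> 0.
Proof.
move=> f0 gC; apply: norm_cvg0.
apply: (@squeeze_cvgr _ _ _ _ (cst 0) (fun x => `|f x| * C)).
- by apply: nearW => x /=; rewrite normr_ge0/= normrM ler_wpM2l.
- exact: cvg_cst.
- rewrite -[X in _ --> X](mul0r C); apply: cvgM; last exact: cvg_cst.
  by rewrite -(@normr0 _ R); exact: cvg_norm.
Qed.

End wave.

(** * Laplace-type integrals of the exponential *)

Section exponential.
Context {R : realType}.
Local Notation mu := (@lebesgue_measure R).

Lemma is_derive_expRZ (c x : R) :
  is_derive x (1:R) (fun y => expR (c * y)) (c * expR (c * x)).
Proof. exact: is_derive_mulr. Qed.

Lemma cvg_expRN (c : R) : 0 < c -> expR (- c * x) @[x --> +oo] --> 0.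
Proof.
move=> c0; under eq_fun do rewrite mulNr.
apply: (@cvg_comp _ _ _ ( *%R c) (fun y => expR (- y))); last exact: cvgr_expR.
apply/cvgryPge => A; near=> x; rewrite -ler_pdivrMl//; near: x.
Unshelve. all: by end_near. Qed.

Lemma continuous_expRN (c : R) : continuous (fun x : R => expR (c * x)).
Proof.
move=> x; apply/differentiable_continuous/derivable1_diffP.
by have [] := is_derive_expRZ c x.
Qed.

Lemma integral_expRN (c : R) : 0 < c ->
  (\int[mu]_(x in `[0%R, +oo[) (expR (- c * x))%:E = (c^-1)%:E)%E.
Proof.
move=> c0.
have dF x :
    is_derive x (1:R) (fun y => - c^-1 * expR (- c * y)) (expR (- c * x)).
  have := is_derive_expRZ (- c) x => d.
  apply: is_derive_eq.
  by rewrite /GRing.scale/= mulrA mulNr mulrN opprK mulVf ?gt_eqF// mul1r.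
rewrite (@ge0_continuous_FTC2y _ _ (fun y => - c^-1 * expR (- c * y)) 0 0).
- by rewrite mulr0 expR0 mulr1 sub0e EFinN oppeK.
- by move=> x _; exact: expR_ge0.
- exact/continuous_subspaceT/continuous_expRN.
- rewrite -(mulr0 (- c^-1)); apply: cvgM; [exact: cvg_cst|exact: cvg_expRN].
- by move=> x _; have [] := dF x.
- apply: cvg_at_right_filter; apply: cvgM; first exact: cvg_cst.
  exact: continuous_expRN.
- by move=> x _; rewrite derive1E; have [_ ->] := dF x.
Qed.

Lemma integrable_expRN (c : R) : 0 < c ->
  mu.-integrable `[0, +oo[ (EFin \o (fun x => expR (- c * x))).
Proof.
move=> c0; apply/integrableP; split.
  apply/measurable_EFinP/measurable_funTS.
  by apply: continuous_measurable_fun; exact: continuous_expRN.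
under eq_integral do rewrite /= ger0_norm ?expR_ge0//.
by rewrite integral_expRN// ltry.
Qed.

Lemma Rintegral_expRN_cos (c xi : R) : 0 < c ->
  \int[mu]_(x in `[0, +oo[) (cos (xi * x) * expR (- c * x)) =
  c / (c ^+ 2 + xi ^+ 2).
Proof.
move=> c0; have q0 : c ^+ 2 + xi ^+ 2 != 0.
  by rewrite gt_eqF// ltr_pwDl ?sqr_ge0// exprn_gt0.
pose q := c ^+ 2 + xi ^+ 2.
(* the real part of the antiderivative exp((- c + i xi) x) / (- c + i xi) *)
pose F x := expR (- c * x) * wave (- (c / q)) (xi / q) xi x.
transitivity (0 - F 0); last first.
  by rewrite /F /wave !mulr0 cos0 sin0 expR0 /q; field.
apply: Rintegral_FTC2y.
- move=> x; have d1 := is_derive_expRZ (- c) x.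
  have d2 := is_derive_wave (- (c / q)) (xi / q) xi x.
  by apply: is_derive_eq; rewrite /wave /GRing.scale/= /q; field.
- move=> x; apply: cvgM; last exact: continuous_expRN.
  under eq_fun do rewrite -wave_cos; rewrite -wave_cos; exact: continuous_wave.
- apply: (integrableM_bounded 1) => //.
  + exact: integrable_expRN.
  + under eq_fun do rewrite -wave_cos; exact: measurable_wave.
  + by move=> x; exact: cos_max.
- by apply: cvg0_bounded; [exact: cvg_expRN | move=> x; exact: le_norm_wave].
Qed.

End exponential.

(** * Fourier transform of the Rosenau kernel *)

Section rosenau.
Context {R : realType} (eps : R) (eps0 : 0 < eps).
Local Notation mu := (@lebesgue_measure R).
Local Notation M := (rosenau_kernel eps).

Lemma rosenau_kernel_ge0 v : 0 <= M v.
Proof. by rewrite mulr_ge0 ?expR_ge0// invr_ge0 mulr_ge0// ltW. Qed.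

Lemma rosenau_kernel_le v : M v <= (2 * eps)^-1.
Proof.
rewrite /rosenau_kernel ler_piMr//; first by rewrite invr_ge0 mulr_ge0// ltW.
by rewrite -expR0 ler_expR oppr_le0 divr_ge0// ltW.
Qed.

Lemma continuous_rosenau_kernel : continuous M.
Proof.
move=> v; apply: cvgM; first exact: cvg_cst.
apply: continuous_comp; last exact: continuous_expR.
apply: cvgN; apply: cvgM; last exact: cvg_cst.
exact: norm_continuous.
Qed.

Lemma measurable_rosenau_kernel : measurable_fun setT M.
Proof. exact: continuous_measurable_fun continuous_rosenau_kernel. Qed.

Lemma rosenau_kernelN v : M (- v) = M v.
Proof. by rewrite /rosenau_kernel normrN. Qed.

Lemma rosenau_kernelE v : 0 <= v -> M v = (2 * eps)^-1 * expR (- eps^-1 * v).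
Proof. by move=> v0; rewrite /rosenau_kernel ger0_norm// mulNr (mulrC v). Qed.

Lemma integrable_rosenau_kernel : mu.-integrable setT (EFin \o M).
Proof.
apply/integrableP; split.
  by apply/measurable_EFinP; exact: measurable_rosenau_kernel.
under eq_integral do rewrite /= ger0_norm ?rosenau_kernel_ge0//.
rewrite ge0_symfun_integralT; last 3 first.
- exact: rosenau_kernel_ge0.
- exact: continuous_rosenau_kernel.
- by move=> x; rewrite /= rosenau_kernelN.
rewrite -set_itvcy lte_mul_pinfty//.
under eq_integral => x xI.
  rewrite rosenau_kernelE; last by move: xI; rewrite inE/= in_itv/= andbT.
  rewrite EFinM; over.
rewrite integralZl//; last by apply: integrable_expRN; rewrite invr_gt0.
by rewrite integral_expRN ?invr_gt0// -EFinM ltry.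
Qed.

Lemma Rintegral_rosenau_cos xi :
  \int[mu]_v (cos (xi * v) * M v) = (1 + (eps * xi) ^+ 2)^-1.
Proof.
have e0 : 0 < eps^-1 by rewrite invr_gt0.
have int : mu.-integrable setT (EFin \o ((fun v => cos (xi * v)) \* M)).
  apply: (integrableM_bounded 1) => //; first exact: integrable_rosenau_kernel.
    by under eq_fun do rewrite -wave_cos; exact: measurable_wave.
  by move=> x; exact: cos_max.
rewrite Rintegral_even//;
  last by move=> v; rewrite /= mulrN cosN rosenau_kernelN.
under eq_Rintegral => x xI.
  rewrite rosenau_kernelE; last by move: xI; rewrite inE/= in_itv/= andbT.
  rewrite mulrCA; over.
rewrite RintegralZl//; last first.
  apply: (integrableM_bounded 1) => //; first exact: integrable_expRN.
    by under eq_fun do rewrite -wave_cos; exact: measurable_wave.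
  by move=> x; exact: cos_max.
rewrite Rintegral_expRN_cos//; field.
by rewrite !gt_eqF// ltr_pwDl// sqr_ge0.
Qed.

Lemma Rintegral_rosenau_sin xi : \int[mu]_v (sin (xi * v) * M v) = 0.
Proof.
apply: Rintegral_odd.
  apply: (integrableM_bounded 1) => //; first exact: integrable_rosenau_kernel.
    by under eq_fun do rewrite -wave_sin; exact: measurable_wave.
  by move=> x; exact: sin_max.
by move=> v; rewrite /= mulrN sinN rosenau_kernelN mulNr.
Qed.

End rosenau.

(** * Fourier transform of the Gaussian *)

Section gaussian.
Context {R : realType} (sigma : R) (sigma0 : 0 < sigma).
Local Notation mu := (@lebesgue_measure R).
Local Notation G := (gaussian sigma).

Lemma gaussianE : G = normal_pdf 0 (Num.sqrt 2 * sigma).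
Proof.
have s0 : Num.sqrt 2 * sigma != 0 :> R.
  by rewrite mulf_neq0// gt_eqF// sqrtr_gt0.
rewrite normal_pdfE//; apply/funext => v.
rewrite /gaussian /normal_peak /normal_fun subr0 exprMn sqr_sqrtr//.
congr (_^-1 * expR _).
  by congr (Num.sqrt _); ring.
by rewrite mulNr -mulr_natr; congr (- (_ / _)); ring.
Qed.

Lemma gaussian_ge0 v : 0 <= G v.
Proof. by rewrite gaussianE normal_pdf_ge0. Qed.

Lemma integrable_gaussian : mu.-integrable setT (EFin \o G).
Proof. by rewrite gaussianE; exact: integrable_normal_pdf. Qed.

Lemma Rintegral_gaussian : \int[mu]_v G v = 1.
Proof. by rewrite gaussianE /Rintegral integral_normal_pdf. Qed.

Lemma gaussianN v : G (- v) = G v.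
Proof. by rewrite /gaussian sqrrN. Qed.

Lemma is_derive_gaussian v :
  is_derive v (1:R) G (- (v / (2 * sigma ^+ 2)) * G v).
Proof.
have d1 : is_derive v (1:R) (fun y => - (y ^+ 2 / (4 * sigma ^+ 2)))
   (- (2 * v / (4 * sigma ^+ 2))).
  by apply: is_derive_eq; rewrite /GRing.scale/=; ring.
have d2 := @is_derive1_comp _ expR _ _ _ _ (is_derive_expR _) d1.
apply: is_derive_eq; rewrite /GRing.scale/= /gaussian.
set p := (Num.sqrt _)^-1; set e := expR _.
by field; rewrite gt_eqF.
Qed.

Lemma continuous_gaussian : continuous G.
Proof.
move=> x; apply/differentiable_continuous/derivable1_diffP.
by have [] := is_derive_gaussian x.
Qed.

Lemma cvg_gaussian : G v @[v --> +oo] --> 0.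
Proof.
rewrite /gaussian -[X in _ --> X](mulr0 (Num.sqrt (4 * pi * sigma ^+ 2))^-1).
apply: cvgM; first exact: cvg_cst.
have -> : (fun x => expR (- (x ^+ 2 / (4 * sigma ^+ 2)))) =
    gauss_fun \o (fun x => (2 * sigma)^-1 * x).
  apply/funext => x; rewrite /gauss_fun /comp.
  have -> : x ^+ 2 / (4 * sigma ^+ 2) = ((2 * sigma)^-1 * x) ^+ 2.
    by field; rewrite gt_eqF.
  by [].
apply: cvg_comp (@cvg_gauss_fun R).
by apply: gt0_cvgMry; [rewrite invr_gt0 mulr_gt0 | exact: cvg_id].
Qed.

(** With a = 1 / (8 sigma^2) the Gaussian is proportional to
    exp(- a v^2) exp(- a v^2); one factor absorbs v, because v is at most
    (1 + 1 / a) (1 + a v^2), and the other is a Gaussian of twice the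
    variance. *)
Lemma le_gaussian_normM :
  exists K, forall v, `|v * G v| <= K * normal_pdf 0 (2 * sigma) v.
Proof.
have s0 : 2 * sigma != 0 by rewrite mulf_neq0// gt_eqF.
pose a := (8 * sigma ^+ 2)^-1.
have a0 : 0 < a by rewrite invr_gt0 mulr_gt0// exprn_gt0.
pose p1 := (Num.sqrt (4 * pi * sigma ^+ 2))^-1.
have p2 := normal_peak_gt0 s0.
exists ((1 + a^-1) * p1 / normal_peak (2 * sigma)) => v.
rewrite normal_pdfE// /normal_fun subr0.
have -> : expR (- v ^+ 2 / ((2 * sigma) ^+ 2 *+ 2)) = expR (- (a * v ^+ 2)).
  by congr expR; rewrite /a; field; rewrite gt_eqF.
set e := expR (- (a * _)); set N := normal_peak _.
have -> : (1 + a^-1) * p1 / N * (N * e) = p1 * ((1 + a^-1) * e).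
  by field; rewrite gt_eqF//= gt_eqF.
rewrite normrM (ger0_norm (gaussian_ge0 _)).
have -> : gaussian sigma v = p1 * (e * e).
  rewrite /gaussian -/p1 /e -expRD; congr (p1 * expR _).
  by rewrite /a; field; rewrite gt_eqF.
rewrite mulrCA ler_wpM2l ?invr_ge0 ?sqrtr_ge0// mulrA ler_wpM2r ?expR_ge0//.
rewrite /e.
rewrite expRN ler_pdivrMr ?expR_gt0//.
apply: (@le_trans _ _ ((1 + a^-1) * (1 + a * v ^+ 2))); last first.
  by rewrite ler_wpM2l ?expR_ge1Dx// addr_ge0// invr_ge0 ltW.
have -> : (1 + a^-1) * (1 + a * v ^+ 2) = 1 + v ^+ 2 + a^-1 + a * v ^+ 2.
  by field; rewrite gt_eqF.
apply: (@le_trans _ _ (1 + v ^+ 2)).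
  rewrite -(real_normK (num_real v)).
  by have := sqr_ge0 (`|v| - 1); have := normr_ge0 v; nra.
rewrite -addrA lerDl addr_ge0//; first by rewrite invr_ge0 ltW.
by rewrite mulr_ge0 ?sqr_ge0// ltW.
Qed.

Lemma integrable_gaussian_normM :
  mu.-integrable setT (EFin \o (fun v => `|v * G v|)).
Proof.
have [K KP] := le_gaussian_normM.
have mT : measurable ([set: R] : set (measurableTypeR R)) by [].
apply: le_integrable
  (integrableZl mT K (integrable_normal_pdf 0 (2 * sigma))) => //.
- apply/measurable_EFinP; apply: measurableT_comp => //.
  apply: measurable_funM => //.
  exact: continuous_measurable_fun continuous_gaussian.
- move=> x _ /=; rewrite lee_fin normr_id.
  exact: le_trans (KP x) (ler_norm _).
Qed.

(** The integrand of the left-hand side minus the right-hand side is the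
    derivative of 2 sigma^2 sin(xi v) G(v), which vanishes at 0 and at
    infinity; being even, that derivative has integral zero over the line. *)
Lemma Rintegral_gaussian_byparts xi :
  \int[mu]_v (- v * sin (xi * v) * G v) =
  - (2 * sigma ^+ 2 * xi) * \int[mu]_v (cos (xi * v) * G v).
Proof.
have ci : mu.-integrable setT (EFin \o ((fun v => cos (xi * v)) \* G)).
  apply: (integrableM_bounded 1) => //; first exact: integrable_gaussian.
    by under eq_fun do rewrite -wave_cos; exact: measurable_wave.
  by move=> x; exact: cos_max.
have si : mu.-integrable setT (EFin \o (fun v => - v * sin (xi * v) * G v)).
  have mG : measurable_fun setT G.
    by apply: continuous_measurable_fun; exact: continuous_gaussian.
  apply: le_integrable integrable_gaussian_normM => //.
    apply/measurable_EFinP; apply: measurable_funM => //.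
    apply: measurable_funM; first exact: measurable_funN.
    by under eq_fun do rewrite -wave_sin; exact: measurable_wave.
  move=> x _ /=; rewrite lee_fin normr_id !normrM normrN ler_wpM2r//.
  by rewrite ler_piMr// sin_max.
pose f v := (2 * sigma ^+ 2 * xi) * (cos (xi * v) * G v) +
  - v * sin (xi * v) * G v.
pose F v := 2 * sigma ^+ 2 * (sin (xi * v) * G v).
have fi : mu.-integrable setT (EFin \o f).
  have -> : EFin \o f =
    ((fun v => (2 * sigma ^+ 2 * xi)%:E * (cos (xi * v) * G v)%:E) \+
     (fun v => (- v * sin (xi * v) * G v)%:E))%E by [].
  by apply: integrableD => //; exact: (integrableZl measurableT _ ci).
have f0 : \int[mu]_v f v = 0.
  rewrite Rintegral_even//; last first.
    by move=> v; rewrite /f !mulrN cosN sinN gaussianN; ring.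
  suff -> : \int[mu]_(v in `[0, +oo[) f v = 0 - F 0.
    by rewrite /F mulr0 sin0 mul0r !mulr0 subr0 mulr0.
  apply: Rintegral_FTC2y.
  - move=> v; have d1 := is_derive_gaussian v.
    have d2 := is_derive_wave 0 1 xi v.
    have -> : F = (fun y => (2 * sigma ^+ 2) * (wave 0 1 xi y * G y)).
      by apply/funext => y; rewrite /F wave_sin.
    apply: is_derive_eq; rewrite /GRing.scale/= /wave /f.
    by field; rewrite gt_eqF.
  - have -> : f = (fun y => (2 * sigma ^+ 2 * xi) * (wave 1 0 xi y * G y) +
       - y * wave 0 1 xi y * G y).
      by apply/funext => y; rewrite wave_sin wave_cos.
    move=> x; apply: cvgD.
      apply: cvgM; first exact: cvg_cst.
      by apply: cvgM; [exact: continuous_wave|exact: continuous_gaussian].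
    apply: cvgM; last exact: continuous_gaussian.
    by apply: cvgM; [apply: cvgN; exact: cvg_id|exact: continuous_wave].
  - exact: integrableS fi.
  - rewrite /F -[X in _ --> X](mulr0 (2 * sigma ^+ 2)).
    apply: cvgM; first exact: cvg_cst.
    under eq_fun do rewrite mulrC.
    apply: (cvg0_bounded _ _ 1); last by move=> x; exact: sin_max.
    exact: cvg_gaussian.
move: f0; rewrite /f RintegralD//; last exact: (integrableZl measurableT _ ci).
by rewrite RintegralZl// addrC => /eqP; rewrite addr_eq0 mulNr => /eqP.
Qed.

(** The derivative in x of cos(x v) G(v) is dominated, uniformly in x, by the
    integrable function |v G(v)|. *)
Lemma is_derive_gaussian_cos xi :
  is_derive xi (1:R) (fun x => \int[mu]_v (cos (x * v) * G v))
    (\int[mu]_v (- v * sin (xi * v) * G v)).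
Proof.
have dE x y : is_derive x (1:R) (fun x => cos (x * y) * G y)
    (- y * sin (x * y) * G y).
  have d1 : is_derive x (1:R) (fun z => cos (z * y)) (y * - sin (y * x)).
    under eq_fun do rewrite mulrC.
    exact: is_derive_mulr.
  by apply: is_derive_eq; rewrite /GRing.scale/= (mulrC x); ring.
have d1E x y : partial1of2 (fun x v => cos (x * v) * G v) x y =
    - y * sin (x * y) * G y.
  by rewrite partial1of2E; have [_ ->] := dE x y.
have Ia : `]xi - 1, xi + 1[%classic xi by rewrite /= in_itv/=; lra.
have ci x : `]xi - 1, xi + 1[%classic x ->
    mu.-integrable setT (EFin \o (fun v => cos (x * v) * G v)).
  move=> _; apply: (integrableM_bounded 1) => //.
    exact: integrable_gaussian.
    by under eq_fun do rewrite -wave_cos; exact: measurable_wave.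
  by move=> v; exact: cos_max.
have df x y : `]xi - 1, xi + 1[%classic x -> [set: R] y ->
  derivable ((fun x v => cos (x * v) * G v)^~ y) x 1.
  by move=> _ _; have [] := dE x y.
have Gge0 y : 0 <= `|y * G y| by [].
have ub x y : `]xi - 1, xi + 1[%classic x -> [set: R] y ->
  `|partial1of2 (fun x v => cos (x * v) * G v) x y| <= `|y * G y|.
  move=> _ _; rewrite d1E !normrM normrN ler_wpM2r//.
  by rewrite ler_piMr// sin_max.
have iG := integrable_gaussian_normM.
apply: DeriveDef.
  exact: (derivable_under_integral measurableT Ia ci df Gge0 iG ub).
rewrite -derive1E
  (differentiation_under_integral measurableT Ia ci df Gge0 iG ub).
by apply: eq_Rintegral => y _; rewrite d1E.
Qed.

(** By the two previous lemmas the integral I satisfies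
    I'(xi) = - 2 sigma^2 xi I(xi), so I(xi) exp(sigma^2 xi^2) is constant,
    equal to its value at 0, the mass of the Gaussian. *)
Lemma Rintegral_gaussian_cos xi :
  \int[mu]_v (cos (xi * v) * G v) = expR (- (sigma ^+ 2 * xi ^+ 2)).
Proof.
pose I x := \int[mu]_v (cos (x * v) * G v).
pose J x := I x * expR (sigma ^+ 2 * x ^+ 2).
have dJ x : is_derive x (1:R) J 0.
  have d1 : is_derive x (1:R) I (- (2 * sigma ^+ 2 * x) * I x).
    by rewrite -Rintegral_gaussian_byparts; exact: is_derive_gaussian_cos.
  have d2 : is_derive x (1:R) (fun y => sigma ^+ 2 * y ^+ 2)
      (sigma ^+ 2 * (2 * x)).
    by apply: is_derive_eq; rewrite /GRing.scale/=; ring.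
  have d3 := @is_derive1_comp _ expR _ _ _ _ (is_derive_expR _) d2.
  by apply: is_derive_eq; rewrite /GRing.scale/=; ring.
have : J xi = J 0 by exact: is_derive_0_is_cst.
rewrite /J /I expr0n mulr0 expR0 mulr1.
under [X in _ = X]eq_Rintegral do rewrite mul0r cos0 mul1r.
rewrite Rintegral_gaussian// expRN => /(canRL (mulfK _)) ->.
  by rewrite mul1r.
by rewrite gt_eqF// expR_gt0.
Qed.

End gaussian.

(** * Testing a convolution against a bounded function *)

Section convolution.
Context {R : realType} (k f : R -> R) (C : R).
Local Notation mu := (@lebesgue_measure R).
Context (ki : mu.-integrable setT (EFin \o k)).
Context (kC : forall v, `|k v| <= C).
Context (fi : mu.-integrable setT (EFin \o f)).

Let mk : measurable_fun setT k.
Proof. by apply/measurable_EFinP; exact: measurable_int ki. Qed.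

Let mf : measurable_fun setT f.
Proof. by apply/measurable_EFinP; exact: measurable_int fi. Qed.

Local Notation T := (measurableTypeR R).

Let kf (z : T * T) : R := k (z.1 - z.2) * f z.2.

Let mkf : measurable_fun setT kf.
Proof.
apply: measurable_funM.
  apply: (measurableT_comp mk).
  by apply: measurable_funB; [exact: measurable_fst|exact: measurable_snd].
by apply: (measurableT_comp mf); exact: measurable_snd.
Qed.

Let shiftE (w v : R) : v - w = affine 1 (- w) v.
Proof. by rewrite /affine mul1r. Qed.

(** By Tonelli and translation invariance, the double integral of the absolute
    value is the product of the L1 norms of k and f. *)
Let kf_integrable : (mu \x mu)%E.-integrable setT (EFin \o kf).
Proof.
apply: (iffRL (integrable21ltyP mu mu _)); first exact/measurable_EFinP.
have -> : (fun w => \int[mu]_v `|(EFin \o kf) (v, w)|)%E =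
    (fun w => (\int[mu]_v `|k v|)%:E * `|(f w)%:E|)%E.
  apply/funext => w.
  have kai : mu.-integrable setT (EFin \o (Num.norm \o k)).
    exact: integrable_norm.
  rewrite -EFin_Rintegral//.
  rewrite (ge0_integral_affine 1 (- w) (EFin \o (Num.norm \o k))) ?oner_eq0//;
    last 2 first.
  - by apply/measurable_EFinP; exact: measurableT_comp.
  - by move=> v; rewrite /= lee_fin.
  have mka : measurable_fun setT
      (fun v => (EFin \o (Num.norm \o k)) (affine 1 (- w) v)).
    have mka0 : measurable_fun setT (k \o affine 1 (- w)).
      by apply: (measurableT_comp mk); exact: measurable_affine.
    by apply/measurable_EFinP; exact: (measurableT_comp _ mka0).
  rewrite normr1 mul1e muleC -ge0_integralZl//;
    last by move=> v _; rewrite /= lee_fin.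
  by apply: eq_integral => v _ /=; rewrite /kf /= normrM EFinM muleC shiftE.
set c := (\int[mu]_v `|k v|).
have c0 : 0 <= c by exact: Rintegral_ge0.
rewrite ge0_integralZl//; last first.
  by apply: measurableT_comp => //; exact/measurable_EFinP.
apply: lte_mul_pinfty => //.
by have /integrableP[] := fi.
Qed.

(** Boundedness of k makes this hold at every v, and not only almost
    everywhere, so the convolution is everywhere the value of a convergent
    integral. *)
Let kf_integrable1 v : mu.-integrable setT (EFin \o (fun w => k (v - w) * f w)).
Proof.
apply: (integrableM_bounded C) => //.
apply: (measurableT_comp mk).
exact: measurable_funB.
Qed.

Lemma integrable_convolution : mu.-integrable setT (EFin \o convolution k f).
Proof.
have -> : EFin \o convolution k f = fubini_F mu (EFin \o kf).
  apply/funext => v; rewrite /fubini_F /kf /=.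
  by rewrite EFin_Rintegral//; exact: kf_integrable1.
exact: integrable_fubini_F kf_integrable.
Qed.

Lemma Rintegral_convolution (phi : R -> R) (D : R) : measurable_fun setT phi ->
  (forall v, `|phi v| <= D) ->
  \int[mu]_v (phi v * convolution k f v) =
  \int[mu]_w (f w * \int[mu]_v (phi v * k (v - w))).
Proof.
move=> mphi phiD.
pose phi1 (z : T * T) : R := phi z.1.
have mphi1 : measurable_fun setT phi1.
  by apply: (measurableT_comp mphi); exact: measurable_fst.
have Fi := integrableM_bounded D measurableT kf_integrable mphi1
  (fun z => phiD z.1).
have phi_kf v : (\int[mu]_w (phi v * (k (v - w) * f w))%:E)%E =
    (phi v * convolution k f v)%:E.
  rewrite EFinM /convolution -EFin_Rintegral; last exact: kf_integrable1.
  by rewrite -integralZl//; exact: kf_integrable1.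
have kphi_f w : (\int[mu]_v (phi v * (k (v - w) * f w))%:E)%E =
    (f w * \int[mu]_v (phi v * k (v - w)))%:E.
  have kwi : mu.-integrable setT (EFin \o (fun v => k (v - w))).
    under eq_fun do rewrite shiftE.
    by apply: (integrable_affine 1 (- w) k) => //; exact: oner_neq0.
  have pki : mu.-integrable setT (EFin \o (fun v => phi v * k (v - w))).
    exact: (integrableM_bounded D).
  rewrite EFinM -(EFin_Rintegral _ pki) -integralZl//.
  by apply: eq_integral => v _; rewrite -EFinM; congr EFin; ring.
have := Fubini Fi; rewrite /phi1 /kf /=.
under eq_integral do rewrite phi_kf.
under [X in _ = X -> _]eq_integral do rewrite kphi_f.
by rewrite /Rintegral => ->.
Qed.

End convolution.

(** * Two facts on exponentials *)

Section exponential_facts.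
Context {R : realType}.

(** F(t) exp(A t) has zero derivative on the open half-line, and the mean
    value theorem on [0, t] asks at 0 only for the one-sided continuity that a
    weak solution provides. *)
Lemma linear_ode (F : R -> R) (A : R) : F s @[s --> 0^'+] --> F 0 ->
  (forall t : R, 0 < t -> is_derive t (1:R) F (- A * F t)) ->
  forall t : R, 0 <= t -> F t = F 0 * expR (- A * t).
Proof.
move=> F0 dF t; rewrite le_eqVlt => /predU1P[<-|t0].
  by rewrite mulr0 expR0 mulr1.
pose G s := F s * expR (A * s).
have dG (s : R) : 0 < s -> is_derive s (1:R) G 0.
  move=> s0; have d1 := dF s s0; have d2 := is_derive_expRZ A s.
  by apply: is_derive_eq; rewrite /GRing.scale/=; ring.
have cG (s : R) : 0 < s -> {for s, continuous G}.
  move=> s0; apply/differentiable_continuous/derivable1_diffP.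
  by have [] := dG s s0.
have [||c _] := @MVT _ G (cst 0) 0 t t0.
- by move=> x; rewrite in_itv/= => /andP[x0 _]; exact: dG.
- apply/(continuous_within_itvP _ t0); split.
  + by move=> x; rewrite in_itv/= => /andP[x0 _]; exact: cG.
  + apply: cvgM => //; apply: cvg_at_right_filter; exact: continuous_expRN.
  + exact/cvg_at_left_filter/cG.
rewrite /G mul0r mulr0 expR0 mulr1 => /eqP; rewrite subr_eq0 => /eqP <-.
by rewrite -mulrA -expRD mulNr subrr expR0 mulr1.
Qed.

(** With u = tau / (1 + d) the gap is exp(-u) (1 - exp(- u d)), at most
    exp(-u) u d.  Its square is exp(-2u) u^2 d^2, and 2 u <= exp(2 u) bounds it
    by u d^2 / 2, which is at most u (1 + d) d / 2 = tau d / 2. *)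
Lemma expR_gap (tau d : R) : 0 <= tau -> 0 <= d ->
  0 <= expR (- (tau / (1 + d))) - expR (- tau) <= Num.sqrt (tau * d / 2).
Proof.
move=> tau0 d0; pose u := tau / (1 + d).
have d1 : 1 + d != 0 by rewrite gt_eqF// ltr_pwDl.
have u0 : 0 <= u by rewrite divr_ge0// addr_ge0.
have tauE : tau = u * (1 + d) by rewrite /u divfK.
rewrite -/u tauE; apply/andP; split.
  by rewrite subr_ge0 ler_expR lerN2 ler_peMr// lerDl.
have -> : expR (- u) - expR (- (u * (1 + d))) =
    expR (- u) * (1 - expR (- (u * d))).
  by rewrite mulrBr mulr1 -expRD; congr (_ - expR _); ring.
apply: (@le_trans _ _ (expR (- u) * (u * d))).
  rewrite ler_wpM2l ?expR_ge0// lerBlDl -lerBlDr.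
  exact: expR_ge1Dx.
have eud0 : 0 <= expR (- u) * (u * d).
  by rewrite mulr_ge0 ?expR_ge0// mulr_ge0.
rewrite -(ger0_norm eud0) -sqrtr_sqr ler_wsqrtr//.
have -> : (expR (- u) * (u * d)) ^+ 2 = expR (- (2 * u)) * u ^+ 2 * d ^+ 2.
  rewrite (_ : - (2 * u) = - u + - u); last by ring.
  by rewrite expRD; ring.
have H : expR (- (2 * u)) * (2 * u) <= 1.
  rewrite expRN mulrC ler_pdivrMr ?expR_gt0// mul1r.
  by apply: le_trans (expR_ge1Dx _); rewrite lerDr.
have := expR_ge0 (- (2 * u)); move: (expR _) H => e H e0.
have : 0 <= u * d ^+ 2 * (1 - e * (2 * u)).
  by rewrite mulr_ge0 ?subr_ge0// mulr_ge0 ?sqr_ge0.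
have : 0 <= u * d by rewrite mulr_ge0.
nra.
Qed.

End exponential_facts.

(** * The equation in Fourier variables *)

Section evolution.
Context {R : realType}.
Local Notation mu := (@lebesgue_measure R).

Lemma integrable_waveM (a b xi : R) (f : R -> R) :
  mu.-integrable setT (EFin \o f) ->
  mu.-integrable setT (EFin \o (fun v => wave a b xi v * f v)).
Proof.
move=> fi; apply: (integrableM_bounded (`|a| + `|b|)) => //.
  exact: measurable_wave.
by move=> v; exact: le_norm_wave.
Qed.

(** Waves are eigenfunctions of the convolution with an even kernel: after the
    translation v = u + w the addition formulas split the wave, and the sine
    part integrates to zero. *)
Lemma Rintegral_rosenau_wave (eps : R) (eps0 : 0 < eps) (a b xi w : R) :
  \int[mu]_v (wave a b xi v * rosenau_kernel eps (v - w)) =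
  (1 + (eps * xi) ^+ 2)^-1 * wave a b xi w.
Proof.
have Mi := integrable_rosenau_kernel eps eps0.
pose f u := wave a b xi (u + w) * rosenau_kernel eps u.
have fE u : f u = wave a b xi w * (wave 1 0 xi u * rosenau_kernel eps u) +
    wave b (- a) xi w * (wave 0 1 xi u * rosenau_kernel eps u).
  by rewrite /f waveD wave_cos wave_sin; ring.
have ci := integrable_waveM 1 0 xi _ Mi.
have si := integrable_waveM 0 1 xi _ Mi.
have ci' := integrableZl measurableT (wave a b xi w) ci.
have si' := integrableZl measurableT (wave b (- a) xi w) si.
have fi : mu.-integrable setT (EFin \o f).
  have -> : EFin \o f = ((fun x =>
        (wave a b xi w)%:E * (wave 1 0 xi x * rosenau_kernel eps x)%:E) \+
      (fun x =>
        (wave b (- a) xi w)%:E * (wave 0 1 xi x * rosenau_kernel eps x)%:E))%E.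
    by apply/funext => u /=; rewrite fE.
  exact: integrableD.
transitivity (\int[mu]_u f u).
  rewrite [RHS](Rintegral_affine 1 (- w)) ?oner_eq0//.
  rewrite normr1 mul1r; apply: eq_Rintegral => v _.
  by rewrite /f /affine mul1r subrK.
under eq_Rintegral do rewrite fE.
rewrite RintegralD// !RintegralZl//.
under eq_Rintegral do rewrite wave_cos.
under [X in _ + _ * X]eq_Rintegral do rewrite wave_sin.
by rewrite Rintegral_rosenau_cos// Rintegral_rosenau_sin// mulr0 addr0 mulrC.
Qed.

Lemma Rintegral_wave_rosenau_convolution (eps : R) (eps0 : 0 < eps)
    (f : R -> R) (a b xi : R) :
  mu.-integrable setT (EFin \o f) ->
  \int[mu]_v (wave a b xi v * (convolution (rosenau_kernel eps) f v - f v)) =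
  ((1 + (eps * xi) ^+ 2)^-1 - 1) * \int[mu]_v (f v * wave a b xi v).
Proof.
move=> fi.
have Mi := integrable_rosenau_kernel eps eps0.
have MC v : `|rosenau_kernel eps v| <= (2 * eps)^-1.
  by rewrite ger0_norm ?rosenau_kernel_le// rosenau_kernel_ge0.
have cvi := integrable_waveM a b xi _ (integrable_convolution _ _ _ Mi MC fi).
have wfi := integrable_waveM a b xi _ fi.
have fwE : \int[mu]_v (f v * wave a b xi v) = \int[mu]_v (wave a b xi v * f v).
  by apply: eq_Rintegral => v _; rewrite mulrC.
under eq_Rintegral do rewrite mulrBr.
rewrite RintegralB//.
rewrite (Rintegral_convolution _ _ _ Mi MC fi _ (`|a| + `|b|)); last 2 first.
- exact: measurable_wave.
- by move=> v; exact: le_norm_wave.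
under eq_Rintegral => w _.
  rewrite Rintegral_rosenau_wave// mulrCA (mulrC (f w)); over.
by rewrite RintegralZl// fwE mulrBl mul1r.
Qed.

Lemma weak_solution_wave (lambda eps : R) (eps0 : 0 < eps) (g0 : R -> R)
    (g : R -> R -> R) (a b xi t : R) :
  weak_solution lambda eps (rosenau_kernel eps) g0 g -> 0 <= t ->
  \int[mu]_v (g v t * wave a b xi v) =
  \int[mu]_v (g0 v * wave a b xi v) *
    expR (- (lambda * xi ^+ 2 / (1 + (eps * xi) ^+ 2)) * t).
Proof.
move=> [gi g00 gsol] t0.
have [F0 dF] := gsol _ (test_function_wave a b xi).
pose F s := \int[mu]_v (g v s * wave a b xi v).
have -> : \int[mu]_v (g0 v * wave a b xi v) = F 0.
  by apply: eq_Rintegral => v _; rewrite g00.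
apply: (linear_ode F) => // s s0.
have := dF s s0.
rewrite Rintegral_wave_rosenau_convolution//; last exact/gi/ltW.
set X := _ * _ => dX.
suff <- : X = - (lambda * xi ^+ 2 / (1 + (eps * xi) ^+ 2)) * F s by [].
rewrite /X /F; field.
by rewrite !gt_eqF// ltr_pwDl// sqr_ge0.
Qed.

Lemma fourierE (f : R -> R) (xi : R) : fourier f xi =
  Complex (\int[mu]_v (f v * wave 1 0 xi v))
          (\int[mu]_v (f v * wave 0 (- 1) xi v)).
Proof.
rewrite /fourier /Cintegral; congr Complex; apply: eq_Rintegral => v _;
  rewrite /wave /= cosN sinN; ring.
Qed.

Lemma fourier_weak_solution (lambda eps : R) (eps0 : 0 < eps) (g0 : R -> R)
    (g : R -> R -> R) (xi t : R) :
  weak_solution lambda eps (rosenau_kernel eps) g0 g -> 0 <= t ->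
  fourier (g^~ t) xi =
  (expR (- (lambda * xi ^+ 2 / (1 + (eps * xi) ^+ 2)) * t))%:C%C *
    fourier g0 xi.
Proof.
move=> gsol t0; rewrite !fourierE.
rewrite !(weak_solution_wave _ _ eps0 _ _ _ _ _ _ gsol t0).
by apply/eqP; rewrite eq_complex /= !mul0r subr0 addr0 !(mulrC (expR _)) !eqxx.
Qed.

Lemma fourier_gaussian (sigma xi : R) : 0 < sigma ->
  fourier (gaussian sigma) xi = (expR (- (sigma ^+ 2 * xi ^+ 2)))%:C%C.
Proof.
move=> s0; have Gi := integrable_gaussian sigma s0.
rewrite fourierE; congr Complex.
  rewrite -Rintegral_gaussian_cos//.
  by apply: eq_Rintegral => v _; rewrite wave_cos mulrC.
apply: Rintegral_odd.
  under eq_fun do rewrite mulrC; exact: integrable_waveM.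
by move=> v; rewrite gaussianN /wave mulrN sinN; ring.
Qed.

Lemma fourier_dilation (f : R -> R) (c xi : R) : 0 < c ->
  mu.-integrable setT (EFin \o f) ->
  fourier (fun v => c^-1 * f (c^-1 * v)) xi = fourier f (c * xi).
Proof.
move=> c0 fi.
suff H a b : \int[mu]_v (c^-1 * f (c^-1 * v) * wave a b xi v) =
    \int[mu]_v (f v * wave a b (c * xi) v).
  by rewrite !fourierE !H.
have ci0 : c^-1 != 0 by rewrite invr_eq0 gt_eqF.
pose h v := f v * wave a b (c * xi) v.
have hi : mu.-integrable setT (EFin \o h).
  by rewrite /h; under eq_fun do rewrite mulrC; exact: integrable_waveM.
have hE v : c^-1 * f (c^-1 * v) * wave a b xi v = c^-1 * h (affine c^-1 0 v).
  rewrite /h /affine addr0 -mulrA; congr (_ * (_ * _)).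
  by rewrite /wave (_ : c * xi * (c^-1 * v) = xi * v)//; field; rewrite gt_eqF.
under eq_Rintegral do rewrite hE.
rewrite RintegralZl//; last exact: (integrable_affine c^-1 0 h).
by rewrite [RHS](Rintegral_affine c^-1 0)// gtr0_norm ?invr_gt0.
Qed.

Lemma normc_real (x : R) : Normc.normc x%:C%C = `|x|.
Proof. by rewrite /Normc.normc /= expr0n addr0 sqrtr_sqr. Qed.

End evolution.

(** * The estimate *)

Theorem proposition4p3 (R : realType) (sigma eps E : R)
  (g0 : R -> R) (g : R -> R -> R)
  (sigma_gt0 : 0 < sigma) (eps_gt0 : 0 < eps)
  (g0_ge0 : forall v, 0 <= g0 v)
  (g0_L12 : in_L12 g0)
  (g0_mass : \int[@lebesgue_measure R]_v g0 v = 1)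
  (g0_mean : \int[@lebesgue_measure R]_v (v * g0 v) = 0)
  (g0_energy : \int[@lebesgue_measure R]_v (v ^+ 2 * g0 v) = E)
  (g_sol : weak_solution (sigma ^+ 2) eps (rosenau_kernel eps) g0 g)
  (t : R) (t_ge0 : 0 <= t) :
  (d2 (rescaled g t) (gaussian sigma) <=
   (1 / (1 + t))%:E * d2 g0 (gaussian sigma) +
   (Num.sqrt (sigma ^+ 2 / 2) * eps * (Num.sqrt t / (1 + t)))%:E)%E.
Proof.
have t1 : 0 < 1 + t by rewrite ltr_pwDl.
pose V := scaling t.
have V0 : 0 < V by exact: powR_gt0.
have V2 : V ^+ 2 = (1 + t)^-1.
  rewrite /V /scaling -powR_mulrn ?powR_ge0// -powRrM.
  rewrite (_ : - (1 / 2) * 2%:R = -1); last by field.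
  by rewrite powR_inv1// ltW.
apply: ge_ereal_sup => _ [xi xi0 <-].
pose eta := V * xi.
have eta0 : eta != 0 by rewrite mulf_neq0// gt_eqF.
have xi2 : `|xi| ^+ 2 = (1 + t) * `|eta| ^+ 2.
  by rewrite !real_normK ?num_real// /eta exprMn V2 mulVKf// gt_eqF.
have [gi _ _] := g_sol.
have gE : fourier (rescaled g t) xi = fourier (g^~ t) eta.
  exact: (fourier_dilation (g^~ t)) (gi t t_ge0).
pose tau := sigma ^+ 2 * eta ^+ 2 * t.
pose d := (eps * eta) ^+ 2.
have tau0 : 0 <= tau by rewrite mulr_ge0// mulr_ge0// sqr_ge0.
have d0 : 0 <= d by exact: sqr_ge0.
pose a := expR (- (tau / (1 + d))).
pose b := expR (- tau).
pose W := expR (- (sigma ^+ 2 * eta ^+ 2)).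
have hE : fourier (rescaled g t) xi = a%:C%C * fourier g0 eta.
  rewrite gE (fourier_weak_solution _ _ eps_gt0 _ _ _ _ g_sol t_ge0) /a /tau /d.
  by congr ((expR _)%:C%C * _); ring.
have wE : fourier (gaussian sigma) xi = (b * W)%:C%C.
  rewrite fourier_gaussian// /b /W -expRD /tau; congr ((expR _)%:C%C).
  by rewrite -(real_normK (num_real xi)) xi2 real_normK ?num_real//; ring.
have splitE : fourier (rescaled g t) xi - fourier (gaussian sigma) xi =
    a%:C%C * (fourier g0 eta - W%:C%C) + ((a - b) * W)%:C%C.
  rewrite hE wE; case: (fourier g0 eta) => z1 z2; apply/eqP.
  by rewrite eq_complex /=; apply/andP; split; apply/eqP; ring.
have a01 : 0 <= a <= 1.
  rewrite expR_ge0 -expR0 ler_expR oppr_le0 divr_ge0//.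
  by rewrite addr_ge0.
have W01 : 0 <= W <= 1.
  by rewrite expR_ge0 -expR0 ler_expR oppr_le0 mulr_ge0 ?sqr_ge0.
have gap := expR_gap tau d tau0 d0; rewrite -/a -/b in gap.
pose N0 := Normc.normc (fourier g0 eta - W%:C%C).
have N00 : 0 <= N0.
  by rewrite /N0; case: (_ - _) => x y; rewrite /Normc.normc sqrtr_ge0.
have normle :
    Normc.normc (fourier (rescaled g t) xi - fourier (gaussian sigma) xi) <=
    N0 + Num.sqrt (tau * d / 2).
  rewrite splitE (le_trans (le_normcD _ _))// lerD//.
    by rewrite Normc.normcM normc_real ger0_norm ?ler_piMl//; case/andP: a01.
  rewrite normc_real; case/andP: gap => ab0 abS; case/andP: W01 => W0 W1.
  by rewrite ger0_norm ?mulr_ge0// (le_trans _ abS)// ler_piMr.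
have rootE : Num.sqrt (tau * d / 2) =
    Num.sqrt (sigma ^+ 2 / 2) * eps * Num.sqrt t * `|eta| ^+ 2.
  have -> : tau * d / 2 = (sigma ^+ 2 / 2) * t * (eps * `|eta| ^+ 2) ^+ 2.
    by rewrite real_normK ?num_real// /tau /d; field.
  have c0 : 0 <= sigma ^+ 2 / 2 by rewrite divr_ge0// sqr_ge0.
  have e0 : 0 <= eps * `|eta| ^+ 2 by rewrite mulr_ge0 ?exprn_ge0// ltW.
  rewrite sqrtrM ?(mulr_ge0 c0)// sqrtrM// sqrtr_sqr (ger0_norm e0).
  by move: (Num.sqrt _) (Num.sqrt _) => s1 s2; ring.
have etap : 0 < `|eta| ^+ 2 by rewrite exprn_gt0// normr_gt0.
apply: (@le_trans _ _ ((1 / (1 + t))%:E * (N0 / `|eta| ^+ 2)%:E +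
    (Num.sqrt (sigma ^+ 2 / 2) * eps * (Num.sqrt t / (1 + t)))%:E)%E).
  rewrite -EFinM -EFinD lee_fin xi2 ler_pdivrMr; last exact: mulr_gt0.
  rewrite (le_trans normle)// rootE le_eqVlt; apply/orP; left; apply/eqP.
  move: (Num.sqrt _) (Num.sqrt _) => s1 s2; field.
  by rewrite gt_eqF//= normr_eq0.
apply: leeD => //; apply: lee_wpmul2l; first by rewrite lee_fin divr_ge0// ltW.
apply: ereal_sup_ubound; exists eta => //=.
by rewrite /N0 -fourier_gaussian.
Qed.
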